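(* Let $m\ge1$ and $N\ge1$ be integers, let $\mathcal L\ge0$, and let $F:[0,1]\to K(\mathbb R^n)$ satisfy $\mathrm{haus}(F(x),F(y))\le\mathcal L|x-y|$ for all $x,y\in[0,1]$. Then for every $x\in\left[\frac{m-1}{N},1\right]$, $$\mathrm{haus}\big(S^M_{m,N}(F,x),F(x)\big)\le\left(2+\left\lfloor\frac{m+1}{2}\right\rfloor\right)\frac{\mathcal L}{N},$$ where $\lfloor t\rfloor$ is the maximal integer not greater than $t$.
   Context: $K(\mathbb R^n)$ is the collection of all nonempty compact subsets of $\mathbb R^n$, $|\cdot|$ is the Euclidean norm, $\mathrm{dist}(a,B)=\inf_{b\in B}|a-b|$, and $\mathrm{haus}(A,B)=\max\{\sup_{a\in A}\mathrm{dist}(a,B),\sup_{b\in B}\mathrm{dist}(b,A)\}$ is the Hausdorff distance. $\Pi_B(a)=\{b\in B:|a-b|=\mathrm{dist}(a,B)\}$. $b_m$ is the (standard, normalized) B-spline of order $m$ (degree $m-1$) with integer knots and support $[0,m]$: $b_1$ is the indicator function of $[0,1)$, and $b_m(t)=\frac{t}{m-1}b_{m-1}(t)+\frac{m-t}{m-1}b_{m-1}(t-1)$ for $m\ge2$. A metric chain of a finite sequence of compact sets $\{A_0,\dots,A_N\}$ is a vector $(a_0,\dots,a_N)$ with $a_i\in A_i$ for all $i$, for which there is $j$, $0\le j\le N$, such that $a_{i-1}\in\Pi_{A_{i-1}}(a_i)$ for $1\le i\le j$ and $a_{i+1}\in\Pi_{A_{i+1}}(a_i)$ for $j\le i\le N-1$.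 $CH(A_0,\dots,A_N)$ denotes the set of all metric chains. The metric Schoenberg operator of order $m$ is $$S^M_{m,N}(F,x)=\Big\{\sum_{i=0}^N b_m(Nx-i)f_i:\ (f_0,\dots,f_N)\in CH\big(F(0),F(1/N),\dots,F(1)\big)\Big\}.$$ *)

(* Defs.v *)
From HB Require Import structures.
From mathcomp Require Import all_boot all_order all_algebra.
From mathcomp Require Import all_classical all_reals all_analysis.

Set Implicit Arguments.
Unset Strict Implicit.
Unset Printing Implicit Defensive.

Import Order.TTheory GRing.Theory Num.Theory.
Import numFieldNormedType.Exports.

Local Open Scope classical_set_scope.
Local Open Scope ring_scope.

(* The canonical norm on 'rV[R]_n is the sup norm, hence a separate
   definition; both norms induce the same topology, so [compact] is the
   usual compactness in R^n. *)
Definition enorm (R : realType) (n : nat) (v : 'rV[R]_n) : R :=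
  Num.sqrt (\sum_(i < n) v 0 i ^+ 2).

(* Distances take values in \bar R, so that infima and suprema are meaningful
   without any nonemptiness or boundedness side condition; for nonempty
   compact sets they are finite. *)
Definition dist (R : realType) (n : nat) (a : 'rV[R]_n) (B : set 'rV[R]_n) :
    \bar R :=
  ereal_inf [set (enorm (a - b))%:E | b in B].

Definition haus (R : realType) (n : nat) (A B : set 'rV[R]_n) : \bar R :=
  maxe (ereal_sup [set dist a B | a in A]) (ereal_sup [set dist b A | b in B]).

Definition metric_proj (R : realType) (n : nat) (B : set 'rV[R]_n)
    (a : 'rV[R]_n) : set 'rV[R]_n :=
  [set b | B b /\ (enorm (a - b))%:E = dist a B].

(* [bspline m] is the B-spline of order m, for m >= 1; the value at m = 0 is
   a dummy. *)
Fixpoint bspline (R : realType) (m : nat) (t : R) : R :=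
  match m with
  | 0 => 0
  | 1 => \1_(`[0, 1[) t
  | (p.+1 as k).+1 =>
      t / k%:R * bspline k t + (m%:R - t) / k%:R * bspline k (t - 1)
  end.

Definition metric_chains (R : realType) (n N : nat)
    (A : 'I_N.+1 -> set 'rV[R]_n) : set ('I_N.+1 -> 'rV[R]_n) :=
  [set a | (forall i, A i (a i)) /\
    exists j : 'I_N.+1,
      (forall h i : 'I_N.+1, i = h.+1 :> nat -> (i <= j)%N ->
         metric_proj (A h) (a i) (a h)) /\
      (forall i k : 'I_N.+1, k = i.+1 :> nat -> (j <= i)%N ->
         metric_proj (A k) (a i) (a k))].

Definition metric_schoenberg (R : realType) (n m N : nat)
    (F : R -> set 'rV[R]_n) (x : R) : set 'rV[R]_n :=
  [set \sum_(i < N.+1) bspline m (N%:R * x - i%:R) *: f i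
     | f in metric_chains (fun i : 'I_N.+1 => F (i%:R / N%:R))].

(* Main.v *)
Require Import Defs.
From mathcomp Require Import all_boot all_order all_algebra.
From mathcomp Require Import all_classical all_reals all_analysis.
From mathcomp Require Import ring lra.

(** Put h = 1/N, u = N x and k = floor u, so that 0 <= k <= N.

    Near x the spline sum is an average: for m - 1 <= u < N + 1 the weights
    w_i = b_m(u - i), 0 <= i <= N, are nonnegative, vanish for i > u, and sum
    to 1 ([sum_bspline]).  Moreover the mean of the nonnegative quantity u - i
    under these weights is at most (m + 1) / 2 ([bspline_moment_le]).  Using
    the first moment is what makes the estimate work: bounding u - i by its
    maximum over the support would only give m, which exceeds the target
    2 + floor((m + 1) / 2) for large m.

    Along a metric chain f of the samples F(0), F(h), ..., F(1), consecutive
    entries are at distance at most L h, since one of them is a nearest point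
    of the other and the sets are L h-close ([metric_chain_step]).  Let y in
    F(x) be such that y and f_k realise a nearest-point pair in one of the two
    directions.  Then |f_k - y| <= L (x - k h) = L h (u - k), and therefore
    |f_i - y| <= L h ((k - i) + (u - k)) = L h (u - i) for every i <= k.
    Averaging ([bspline_average_le]),

      |sum_i w_i f_i - y| <= L h sum_i w_i (u - i) <= L h (m + 1) / 2,

    and (m + 1) / 2 < 1 + floor((m + 1) / 2).

    Both halves of the Hausdorff distance are instances of this.  Given a
    chain f, take for y a nearest point of f_k in F(x).  Given y in F(x), take
    a nearest point of y in F(k h) and extend it by successive projections in
    both directions to a metric chain with pivot k ([metric_chain_through]). *)

Set Implicit Arguments.
Unset Strict Implicit.
Unset Printing Implicit Defensive.

Import Order.TTheory GRing.Theory Num.Theory.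
Import numFieldNormedType.Exports.

Local Open Scope classical_set_scope.
Local Open Scope ring_scope.

(** * The Euclidean norm *)

Lemma sum_sqr_ge0 (R : realType) (n : nat) (a : 'I_n -> R) :
  0 <= \sum_(i < n) a i ^+ 2.
Proof. by apply: sumr_ge0 => i _; exact: sqr_ge0. Qed.

Lemma cauchy_schwarz_sum (R : realType) (n : nat) (a b : 'I_n -> R) :
  (\sum_(i < n) a i * b i) ^+ 2
    <= (\sum_(i < n) a i ^+ 2) * (\sum_(i < n) b i ^+ 2).
Proof.
set A := \sum_(i < n) a i ^+ 2; set B := \sum_(i < n) b i ^+ 2.
set C := \sum_(i < n) a i * b i.
have B_ge0 : 0 <= B by exact: sum_sqr_ge0.
have [B0|B_neq0] := eqVneq B 0.
  have b0 i : b i = 0.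
    apply/eqP; rewrite -sqrf_eq0; apply/eqP.
    by move/psumr_eq0P: B0; apply=> // j _; exact: sqr_ge0.
  rewrite /C big1 ?expr0n /= ?B0 ?mulr0 // => i _.
  by rewrite b0 mulr0.
have B_gt0 : 0 < B by rewrite lt_neqAle eq_sym B_neq0.
(* This is |B a - C b|^2, where C / B is the coefficient of the orthogonal
   projection of a onto the line spanned by b. *)
have : 0 <= \sum_(i < n) (B * a i - C * b i) ^+ 2 by exact: sum_sqr_ge0.
have -> : \sum_(i < n) (B * a i - C * b i) ^+ 2 = B * (A * B - C ^+ 2).
  rewrite (eq_bigr (fun i => B ^+ 2 * a i ^+ 2 - 2 * B * C * (a i * b i)
                             + C ^+ 2 * b i ^+ 2)); last by move=> i _; ring.
  rewrite big_split sumrB /= -!mulr_sumr -/A -/B -/C. ring.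
by rewrite pmulr_rge0 // subr_ge0.
Qed.

Lemma enorm_ge0 (R : realType) (n : nat) (v : 'rV[R]_n) : 0 <= enorm v.
Proof. exact: sqrtr_ge0. Qed.

Lemma enorm_sqr (R : realType) (n : nat) (v : 'rV[R]_n) :
  enorm v ^+ 2 = \sum_(i < n) v 0 i ^+ 2.
Proof. by rewrite sqr_sqrtr // sum_sqr_ge0. Qed.

Lemma enorm0 (R : realType) (n : nat) : enorm (0 : 'rV[R]_n) = 0.
Proof.
by rewrite /enorm big1 ?sqrtr0 // => i _; rewrite mxE expr0n.
Qed.

Lemma enormZ (R : realType) (n : nat) (c : R) (v : 'rV[R]_n) :
  0 <= c -> enorm (c *: v) = c * enorm v.
Proof.
move=> c0; rewrite /enorm.
under eq_bigr do rewrite mxE exprMn.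
by rewrite -mulr_sumr sqrtrM ?sqr_ge0 // sqrtr_sqr ger0_norm.
Qed.

Lemma enormN (R : realType) (n : nat) (v : 'rV[R]_n) : enorm (- v) = enorm v.
Proof. by rewrite /enorm; under eq_bigr do rewrite mxE sqrrN. Qed.

Lemma enorm_distC (R : realType) (n : nat) (u v : 'rV[R]_n) :
  enorm (u - v) = enorm (v - u).
Proof. by rewrite -enormN opprB. Qed.

Lemma enormD (R : realType) (n : nat) (u v : 'rV[R]_n) :
  enorm (u + v) <= enorm u + enorm v.
Proof.
rewrite -(@ler_pXn2r _ 2) ?nnegrE ?addr_ge0 ?enorm_ge0 //.
have -> : enorm (u + v) ^+ 2
    = enorm u ^+ 2 + 2 * (\sum_(i < n) u 0 i * v 0 i) + enorm v ^+ 2.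
  rewrite !enorm_sqr mulr_sumr -!big_split /=.
  by apply: eq_bigr => i _; rewrite mxE; ring.
have CS : \sum_(i < n) u 0 i * v 0 i <= enorm u * enorm v.
  rewrite (le_trans (ler_norm _)) //.
  rewrite -(@ler_pXn2r _ 2) ?nnegrE ?mulr_ge0 ?enorm_ge0 //.
  by rewrite real_normK ?num_real // exprMn !enorm_sqr cauchy_schwarz_sum.
by move: CS; lra.
Qed.

Lemma enorm_dist_triangle (R : realType) (n : nat) (v u w : 'rV[R]_n) :
  enorm (u - w) <= enorm (u - v) + enorm (v - w).
Proof. by rewrite (le_trans _ (enormD _ _)) // addrA subrK. Qed.

Lemma enorm_sum (R : realType) (n N : nat) (f : 'I_N -> 'rV[R]_n) :
  enorm (\sum_(i < N) f i) <= \sum_(i < N) enorm (f i).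
Proof.
elim/big_ind2: _ => [|u a v b ua vb|//]; first by rewrite enorm0.
by rewrite (le_trans (enormD _ _)) // lerD.
Qed.

(** * Nearest points and the Hausdorff distance *)

(** A continuous function attains its minimum on a compact set; the squared
    distance to a is a polynomial in the coordinates, and it has the same
    minimisers as the distance. *)
Lemma metric_proj_nonempty (R : realType) (n : nat) (B : set 'rV[R]_n)
    (a : 'rV[R]_n) :
  B !=set0 -> compact B -> metric_proj B a !=set0.
Proof.
move=> B0 cB.
pose q (b : 'rV[R]_n) := \sum_(i < n) (a 0 i - b 0 i) ^+ 2.
have qE b : enorm (a - b) = Num.sqrt (q b).
  by rewrite /enorm /q; under eq_bigr do rewrite !mxE.
have cq : continuous q.
  apply: (@continuous_big _ _ +%R) => [|i _ b]; first exact: add_continuous.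
  have ci : (fun M : 'rV[R]_n => M 0 i) @ b --> b 0 i by exact: coord_continuous.
  have cai : (fun M : 'rV[R]_n => a 0 i - M 0 i) @ b --> a 0 i - b 0 i.
    by apply: cvgB ci; exact: cvg_cst.
  exact: (cvgM cai cai).
have [b Bb bmin] := compact_EVT_min B0 cB (continuous_subspaceT cq).
have {}Bb : B b by move: Bb; rewrite inE.
exists b; split=> //; apply/eqP; rewrite eq_le; apply/andP; split.
  apply: le_ereal_inf_tmp => _ [c Bc <-].
  by rewrite lee_fin !qE ler_wsqrtr // bmin // inE.
by apply: ereal_inf_lbound; exists b.
Qed.

Lemma dist_le_enorm (R : realType) (n : nat) (B : set 'rV[R]_n)
    (a b : 'rV[R]_n) : B b -> (dist a B <= (enorm (a - b))%:E)%E.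
Proof. by move=> Bb; apply: ereal_inf_lbound; exists b. Qed.

Lemma metric_proj_haus (R : realType) (n : nat) (A B : set 'rV[R]_n)
    (a b : 'rV[R]_n) (e : R) :
  A a -> metric_proj B a b -> (haus A B <= e%:E)%E -> enorm (a - b) <= e.
Proof.
move=> Aa [_ ab] hAB; rewrite -lee_fin ab (le_trans _ hAB) //.
by rewrite le_max ereal_sup_ubound //; exists a.
Qed.

Lemma haus_leP (R : realType) (n : nat) (A B : set 'rV[R]_n) (e : R) :
  (forall a, A a -> exists2 b, B b & enorm (a - b) <= e) ->
  (forall b, B b -> exists2 a, A a & enorm (b - a) <= e) ->
  (haus A B <= e%:E)%E.
Proof.
move=> AB BA; rewrite ge_max; apply/andP; split.
  apply: ge_ereal_sup => _ [a /AB[b Bb ab] <-].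
  by rewrite (le_trans (dist_le_enorm _ Bb)) // lee_fin.
apply: ge_ereal_sup => _ [b /BA[a Aa ba] <-].
by rewrite (le_trans (dist_le_enorm _ Aa)) // lee_fin.
Qed.

(** * Metric chains *)

(** The chain is obtained by iterating a choice of nearest points downwards
    and upwards from the pivot k, whose entry is prescribed. *)
Lemma metric_chain_through (R : realType) (n N : nat)
    (A : 'I_N.+1 -> set 'rV[R]_n) (k : 'I_N.+1) (c : 'rV[R]_n) :
  (forall i, A i !=set0 /\ compact (A i)) -> A k c ->
  exists2 f, metric_chains A f & f k = c.
Proof.
move=> cA Akc.
have /choice[P PP] : forall z : 'I_N.+1 * 'rV[R]_n,
    exists b, metric_proj (A z.1) z.2 b.
  by move=> z; have [A0 Ac] := cA z.1; exact: metric_proj_nonempty.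
(* down d and up d are the entries at the indices k - d and k + d. *)
pose down := fix down d :=
  if d is e.+1 then P (inord (k - d), down e) else c.
pose up := fix up d := if d is e.+1 then P (inord (k + d), up e) else c.
pose f (i : 'I_N.+1) := if (i <= k)%N then down (k - i)%N else up (i - k)%N.
exists f; last by rewrite /f leqnn subnn.
have fdown (h i : 'I_N.+1) :
    i = h.+1 :> nat -> (i <= k)%N -> metric_proj (A h) (f i) (f h).
  move=> ih ik; have hk : (h < k)%N by rewrite -ih.
  rewrite /f ik (ltnW hk) -(subnSK hk) -ih /=.
  have -> : inord (k - (k - i).+1) = h.
    by apply: val_inj; rewrite /= ih subnSK // subKn ?(ltnW hk) // inordK.
  exact: (PP (h, _)).
have fup (i h : 'I_N.+1) :
    h = i.+1 :> nat -> (k <= i)%N -> metric_proj (A h) (f i) (f h).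
  move=> hi ki; have kh : (k < h)%N by rewrite hi.
  have -> : f i = up (i - k)%N.
    rewrite /f; case: leqP => // ik.
    have -> : (i = k :> nat) by apply/eqP; rewrite eqn_leq ik ki.
    by rewrite subnn.
  rewrite /f leqNgt kh /= hi subSn //=.
  have -> : inord (k + (i - k).+1) = h.
    by apply: val_inj; rewrite /= addnS subnKC // -hi inordK.
  exact: (PP (h, _)).
split; last by exists k.
move=> i; have [ik|ki|/val_inj ik] := ltngtP i k.
- have iN : (i.+1 < N.+1)%N by exact: leq_ltn_trans ik (ltn_ord k).
  by case: (fdown i (Ordinal iN)).
- have iN : (i.-1 < N.+1)%N by exact: leq_ltn_trans (leq_pred i) (ltn_ord i).
  case: (fup (Ordinal iN) i) => //=; first by rewrite (ltn_predK ki).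
  by rewrite -ltnS (ltn_predK ki).
- by rewrite ik /f leqnn subnn.
Qed.

(** Whichever side of the pivot the two indices lie on, one entry is a
    nearest point of the other, so their distance is that of a point of one
    sample set to the other sample set. *)
Lemma metric_chain_step (R : realType) (n N : nat)
    (A : 'I_N.+1 -> set 'rV[R]_n) (d : R) (f : 'I_N.+1 -> 'rV[R]_n) :
  (forall h i : 'I_N.+1, (i = h.+1 :> nat) \/ (h = i.+1 :> nat) ->
     (haus (A i) (A h) <= d%:E)%E) ->
  metric_chains A f ->
  forall h i : 'I_N.+1, i = h.+1 :> nat -> enorm (f h - f i) <= d.
Proof.
move=> hA [Af [j [fdown fup]]] h i ih.
have [ij|ji] := leqP i j.
  rewrite enorm_distC.
  by apply: metric_proj_haus (Af i) (fdown _ _ ih ij) _; apply: hA; left.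
have jh : (j <= h)%N by rewrite -ltnS -ih.
by apply: metric_proj_haus (Af h) (fup _ _ ih jh) _; apply: hA; right.
Qed.

Lemma enorm_chain_le (R : realType) (n N : nat) (d : R)
    (f : 'I_N.+1 -> 'rV[R]_n) :
  (forall h i : 'I_N.+1, i = h.+1 :> nat -> enorm (f h - f i) <= d) ->
  forall i k : 'I_N.+1, (i <= k)%N -> enorm (f i - f k) <= d * (k%:R - i%:R).
Proof.
move=> step i [k kN] /=; elim: k kN => [|k IHk] kN ik.
  have -> : i = Ordinal kN by apply: val_inj; apply/eqP; rewrite -leqn0.
  by rewrite !subrr enorm0 mulr0.
have [ik'|ik'] := eqVneq (i : nat) k.+1.
  have -> : i = Ordinal kN by apply: val_inj.
  by rewrite !subrr enorm0 mulr0.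
have {ik'}ik : (i <= k)%N by rewrite -ltnS ltn_neqAle ik'.
have kN' := ltnW kN.
have := enorm_dist_triangle (f (Ordinal kN')) (f i) (f (Ordinal kN)).
have := IHk kN' ik; have := step (Ordinal kN') (Ordinal kN) erefl.
rewrite -natr1; lra.
Qed.

(** * B-spline weights *)

Local Arguments bspline : simpl never.

Lemma bsplineS (R : realType) (m : nat) (t : R) : (0 < m)%N ->
  bspline m.+1 t = t / m%:R * bspline m t
                   + (m.+1%:R - t) / m%:R * bspline m (t - 1).
Proof. by case: m. Qed.

Lemma bspline_eq0 (R : realType) (m : nat) (t : R) : (0 < m)%N ->
  t < 0 \/ m%:R <= t -> bspline m t = 0.
Proof.
case: m => // m _; elim: m t => [|m IHm] t t_out.
  rewrite /bspline indicE memNset //= in_itv /= => /andP[t0 t1].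
  by case: t_out; lra.
have m1 : (m.+2%:R : R) = m.+1%:R + 1 by rewrite natr1.
rewrite bsplineS // !IHm ?mulr0 ?addr0 //; case: t_out; rewrite ?m1 => ?;
  by [left; lra|right; lra].
Qed.

Lemma bspline_ge0 (R : realType) (m : nat) (t : R) : 0 <= bspline m t.
Proof.
case: m => // m; elim: m t => [|m IHm] t; first by rewrite /bspline indicE.
have [t0|t0] := ltP t 0; first by rewrite bspline_eq0 //; left.
have [tm|tm] := leP m.+2%:R t; first by rewrite bspline_eq0 //; right.
by rewrite bsplineS // addr_ge0 // mulr_ge0 ?IHm // divr_ge0 // subr_ge0 ltW.
Qed.

(** The recurrence for splines, transposed to the test function g.  Shifting
    the index in the terms b_m (u - i - 1) is legitimate on the finite range
    0 <= i <= N because the two boundary terms, b_m u and b_m (u - N - 1), lie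
    outside the support.  Taking g constant and g the identity gives
    recurrences for the total mass and for the first moment. *)
Lemma sum_bspline_rec (R : realType) (m N : nat) (u : R) (g : R -> R) :
  (0 < m)%N -> m%:R <= u < N.+1%:R ->
  \sum_(i < N.+1) bspline m.+1 (u - i%:R) * g (u - i%:R) =
  \sum_(i < N.+1) bspline m (u - i%:R) *
    ((u - i%:R) / m%:R * g (u - i%:R)
     + (m%:R - (u - i%:R)) / m%:R * g (u - i%:R + 1)).
Proof.
move=> m0 /andP[mu uN].
pose H s := bspline m s * ((m%:R - s) / m%:R * g (s + 1)).
have shift : \sum_(i < N.+1) H (u - i%:R - 1) = \sum_(i < N.+1) H (u - i%:R).
  have H_out s : s < 0 \/ m%:R <= s -> H s = 0.
    by move=> s_out; rewrite /H bspline_eq0 // mul0r.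
  have := erefl (\sum_(i < N.+2) H (u - i%:R)).
  rewrite [LHS]big_ord_recl [RHS]big_ord_recr /= subr0.
  rewrite (H_out u) ?add0r; last by right.
  rewrite (H_out (u - N.+1%:R)) ?addr0; last by left; rewrite subr_lt0.
  move=> <-; apply: eq_bigr => i _.
  by rewrite /bump /= natrD opprD addrA addrAC.
transitivity (\sum_(i < N.+1)
    (bspline m (u - i%:R) * ((u - i%:R) / m%:R * g (u - i%:R))
     + H (u - i%:R - 1))).
  apply: eq_bigr => i _; rewrite bsplineS // /H subrK -natr1.
  ring.
rewrite big_split /= shift -big_split /=.
by apply: eq_bigr => i _; rewrite -mulrDr.
Qed.

Lemma sum_bspline1 (R : realType) (N : nat) (u : R) (g : R -> R) :
  0 <= u < N.+1%:R ->
  \sum_(i < N.+1) bspline 1 (u - i%:R) * g (u - i%:R)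
    = g (u - (Num.truncn u)%:R).
Proof.
move=> /andP[u0 uN].
have kN : (Num.truncn u < N.+1)%N by rewrite truncn_lt_nat.
rewrite (bigD1 (Ordinal kN)) //= big1 ?addr0.
  have /andP[ku uk] := truncn_itv u0.
  rewrite /bspline indicE mem_set ?mul1r //= in_itv /= subr_ge0 ku /=.
  by move: uk; rewrite -natr1; lra.
move=> i ik; rewrite /bspline indicE memNset ?mul0r //= in_itv /= => /andP[iu ui].
move/eqP: ik; apply; apply: val_inj => /=; apply/esym/truncn_def.
by rewrite -natr1; lra.
Qed.

(** For g = 1 the transposed recurrence has coefficients summing to 1, so the
    mass does not depend on the order. *)
Lemma sum_bspline (R : realType) (m N : nat) (u : R) :
  (0 < m)%N -> m%:R - 1 <= u < N.+1%:R ->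
  \sum_(i < N.+1) bspline m (u - i%:R) = 1.
Proof.
case: m => // m _; elim: m => [|m IHm] /andP[mu uN].
  under eq_bigr do rewrite -[bspline _ _]mulr1.
  by rewrite (@sum_bspline1 _ _ _ (fun=> 1)) // uN andbT; lra.
have m1 : (m.+2%:R : R) = m.+1%:R + 1 by rewrite natr1.
under eq_bigr do rewrite -[bspline _ _]mulr1.
rewrite (@sum_bspline_rec _ _ _ _ (fun=> 1)) //; last by rewrite uN andbT; lra.
rewrite -[RHS]IHm; last by rewrite uN andbT; lra.
apply: eq_bigr => i _; rewrite !mulr1 -mulrDl subrKC divff ?mulr1 //.
Qed.

(** For g = id the transposed recurrence reads
    M_{m+1} = (m - 1) / m * M_m + 1.  Its solution is M_m = m / 2 for m >= 2,
    but M_1 is the fractional part of u; the bound (m + 1) / 2 covers both and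
    is preserved by the recurrence, since
    (m - 1) (m + 1) / (2 m) + 1 <= (m + 2) / 2. *)
Lemma bspline_moment_le (R : realType) (m N : nat) (u : R) :
  (0 < m)%N -> m%:R - 1 <= u < N.+1%:R ->
  \sum_(i < N.+1) bspline m (u - i%:R) * (u - i%:R) <= (m%:R + 1) / 2.
Proof.
case: m => // m _; elim: m => [|m IHm] /andP[mu uN].
  rewrite (@sum_bspline1 _ _ _ id) //; last by rewrite uN andbT; lra.
  have /truncn_itv : 0 <= u by lra.
  by rewrite -natr1 => ?; lra.
have m1 : (m.+2%:R : R) = m.+1%:R + 1 by rewrite natr1.
have u_itv : m.+1%:R - 1 <= u < N.+1%:R by rewrite uN andbT; lra.
rewrite (@sum_bspline_rec _ _ _ _ id) //; last by rewrite uN andbT; lra.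
set M : R := m.+1%:R in m1 mu u_itv IHm *.
have M1 : 1 <= M by rewrite ler1n.
rewrite (eq_bigr (fun i : 'I_N.+1 =>
  (M - 1) / M * (bspline m.+1 (u - i%:R) * (u - i%:R))
  + bspline m.+1 (u - i%:R))); last first.
  by move=> i _; field; lra.
rewrite big_split /= -mulr_sumr sum_bspline //.
have c0 : 0 <= (M - 1) / M by rewrite divr_ge0 ?subr_ge0 //; lra.
have := ler_wpM2l c0 (IHm u_itv).
have -> : (M - 1) / M * ((M + 1) / 2) = M / 2 - M^-1 / 2 by field; lra.
have : 0 <= M^-1 by rewrite invr_ge0; lra.
move: M^-1 => v v0 IH; rewrite m1 -lerBrDr (le_trans IH) //; lra.
Qed.

(** * The approximation estimate *)

Lemma bspline_average_le (R : realType) (n m N : nat) (u d : R)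
    (f : 'I_N.+1 -> 'rV[R]_n) (y : 'rV[R]_n) :
  (0 < m)%N -> m%:R - 1 <= u < N.+1%:R -> 0 <= d ->
  (forall i : 'I_N.+1, i%:R <= u -> enorm (f i - y) <= d * (u - i%:R)) ->
  enorm (\sum_(i < N.+1) bspline m (u - i%:R) *: f i - y)
    <= (m%:R + 1) / 2 * d.
Proof.
move=> m0 u_itv d0 fy.
have -> : \sum_(i < N.+1) bspline m (u - i%:R) *: f i - y
    = \sum_(i < N.+1) bspline m (u - i%:R) *: (f i - y).
  under [RHS]eq_bigr do rewrite scalerBr.
  by rewrite sumrB -scaler_suml sum_bspline // scale1r.
apply: le_trans (enorm_sum _) _.
apply: le_trans (ler_wpM2r d0 (bspline_moment_le m0 u_itv)).
rewrite mulr_suml; apply: ler_sum => i _.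
rewrite enormZ ?bspline_ge0 //.
have [iu|ui] := leP i%:R u; last first.
  by rewrite bspline_eq0 ?mul0r //; left; rewrite subr_lt0.
by rewrite -mulrA ler_wpM2l ?bspline_ge0 // mulrC fy.
Qed.

Theorem corollary6p6 (R : realType) (n m N : nat) (L : R)
    (F : R -> set 'rV[R]_n) :
  (1 <= m)%N -> (1 <= N)%N -> 0 <= L ->
  (forall x : R, 0 <= x <= 1 -> F x !=set0 /\ compact (F x)) ->
  (forall x y : R, 0 <= x <= 1 -> 0 <= y <= 1 ->
     (haus (F x) (F y) <= (L * `|x - y|)%:E)%E) ->
  forall x : R, (m%:R - 1) / N%:R <= x <= 1 ->
    (haus (metric_schoenberg m N F x) (F x)
       <= ((2 + (Num.floor ((m%:R + 1) / 2 : R))%:~R) * (L / N%:R))%:E)%E.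
Proof.
move=> m1 N1 L0 Fcpt Flip x /andP[mx x1].
have N0 : (0 : R) < N%:R by rewrite ltr0n.
have m1R : (1 : R) <= m%:R by rewrite ler1n.
pose d := L / N%:R; pose u := N%:R * x.
have d0 : 0 <= d by rewrite divr_ge0 // ltW.
have mu : m%:R - 1 <= u by rewrite /u mulrC -ler_pdivrMr.
have uN : u <= N%:R by rewrite /u ger_pMr.
have u0 : 0 <= u by lra.
have x01 : 0 <= x <= 1 by rewrite x1 andbT -(pmulr_rge0 _ N0).
have u_itv : m%:R - 1 <= u < N.+1%:R by rewrite mu -natr1 /=; lra.
have kN : (Num.truncn u < N.+1)%N by rewrite truncn_lt_nat //; case/andP: u_itv.
pose k := Ordinal kN.
have ku : k%:R <= u by case/andP: (truncn_itv u0).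
have node (i : 'I_N.+1) : 0 <= (i%:R / N%:R : R) <= 1.
  by rewrite divr_ge0 //= ler_pdivrMr // mul1r ler_nat -ltnS ltn_ord.
have kx : L * `|k%:R / N%:R - x| = d * (u - k%:R).
  rewrite distrC ger0_norm; last by rewrite subr_ge0 ler_pdivrMr // mulrC.
  by rewrite /d /u; field; rewrite gt_eqF.
pose A (i : 'I_N.+1) := F (i%:R / N%:R).
have hA (h i : 'I_N.+1) : (i = h.+1 :> nat) \/ (h = i.+1 :> nat) ->
    (haus (A i) (A h) <= d%:E)%E.
  move=> hi; apply: le_trans (Flip _ _ (node i) (node h)) _.
  rewrite lee_fin -mulrBl normrM normfV normr_nat.
  have -> : `|i%:R - h%:R| = 1 :> R.
    by case: hi => ->; [|rewrite distrC];
      rewrite -natr1 addrAC subrr add0r normr1.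
  by rewrite mul1r.
(* The common estimate for both halves of the Hausdorff distance. *)
have key f y : metric_chains A f -> enorm (f k - y) <= d * (u - k%:R) ->
    enorm (\sum_(i < N.+1) bspline m (u - i%:R) *: f i - y)
      <= (2 + (Num.floor ((m%:R + 1) / 2 : R))%:~R) * d.
  move=> chf fky; apply: (@le_trans _ _ ((m%:R + 1) / 2 * d)); last first.
    rewrite ler_wpM2r //.
    have := floorD1_gt ((m%:R + 1) / 2 : R); rewrite intrD; lra.
  apply: bspline_average_le => // i iu.
  have ik : (i <= k)%N by rewrite /= truncn_ge_nat.
  have := enorm_chain_le (metric_chain_step hA chf) ik.
  by have := enorm_dist_triangle (f k) (f i) y; lra.
apply: haus_leP => [s [f chf <-]|y Fy].
  have [F0 Fc] := Fcpt x x01.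
  have [y fy] := metric_proj_nonempty (f k) F0 Fc.
  exists y; first by case: fy.
  apply: key => //; rewrite -kx.
  apply: metric_proj_haus fy (Flip _ _ (node k) x01).
  by case: chf => Af _; exact: Af.
have [A0 Ac] := Fcpt _ (node k).
have [c yc] := metric_proj_nonempty y A0 Ac.
have [|f chf fk] := @metric_chain_through _ _ _ A k c (fun i => Fcpt _ (node i)).
  by case: yc.
exists (\sum_(i < N.+1) bspline m (u - i%:R) *: f i); first by exists f.
rewrite enorm_distC; apply: key => //; rewrite fk enorm_distC -kx distrC.
exact: metric_proj_haus Fy yc (Flip _ _ x01 (node k)).
Qed.
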